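(* Consider the case $\sigma_k=0$. Let $\mathcal{U}$ be the domain of the extended decision vector $\bm{U}=(\bm{u}^\top,T)^\top\in\mathbb{R}^{Nm+1}$, where the following are assumed to hold: (A1) $\frac{\partial \bm{G}}{\partial \bm{u}}$ is full row rank for all $\bm{U}\in\mathcal{U}$. (A2) $\left\|\left(\frac{\partial \bm{G}}{\partial \bm{u}}\right)^{+}\right\|_1\le \alpha_1$ for all $\bm{U}\in\mathcal{U}$. (A3) There exists $\lambda>0$ such that for all $\bm{U}'=(\bm{u}'^\top,T')^\top$ and $\bm{U}''=(\bm{u}''^\top,T'')^\top$ in $\mathcal{U}$ with $|T'-T''|\le\bar S$, one has $\|\mathcal{J}_{\bm{G}}(\bm{U}')-\mathcal{J}_{\bm{G}}(\bm{U}'')\|_1\le\lambda\|\bm{U}'-\bm{U}''\|_1$. (A4) $\lambda(\alpha_1+\alpha_2)^2\|\bm{G}(\bm{U}_0)\|_1/2<1$. Then, for the iterates $\bm{U}_k$ generated from the initial guess $\bm{U}_0$ by the free-horizon Newton update (defined in the context) with $\sigma_k=0$, the error $\|\bm{G}(\bm{U}_k)\|_1$ achieves quadratic convergence, i.e. $\|\bm{G}(\bm{U}_k)\|_1\to0$ as $k\to\infty$ and there is a constant $C>0$ such that $\|\bm{G}(\bm{U}_{k+1})\|_1\le C\|\bm{G}(\bm{U}_k)\|_1^2$ for all $k\ge0$.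
   Context: Setting. Fix positive integers $n,m,N$, an initial state $\bm{x}_0\in\mathbb{R}^n$ and a target state $\bm{x}_{\mathrm f}\in\mathbb{R}^n$. The discrete-time dynamics (obtained from a continuous-time control system by a discretization scheme such as fourth-order Runge--Kutta with zero-order hold on the input) are $$\bm{x}[j+1]=\bm{f}(\bm{x}[j],\widetilde{\bm{u}}[j];\tau),\quad j=0,\dots,N-1,\qquad \bm{x}[0]=\bm{x}_0,\qquad \tau=T/N,$$ with states $\bm{x}[j]\in\mathbb{R}^n$, inputs $\widetilde{\bm{u}}[j]\in\mathbb{R}^m$, and control horizon $T>0$, which is a free variable. Write $\bm{u}=[\widetilde{\bm{u}}[0]^\top,\dots,\widetilde{\bm{u}}[N-1]^\top]^\top\in\mathbb{R}^{Nm}$ and define the extended decision vector $\bm{U}=(\bm{u}^\top,T)^\top\in\mathbb{R}^{Nm+1}$. The terminal state $\bm{x}[N]$ is a function of $\bm{U}$, and $$\bm{G}(\bm{U})=\bm{x}[N](\bm{U})-\bm{x}_{\mathrm f}\in\mathbb{R}^n,\qquad \mathcal{J}_{\bm{G}}(\bm{U})=\left(\frac{\partial\bm{G}}{\partial\bm{u}},\frac{\partial\bm{G}}{\partial T}\right)\in\mathbb{R}^{n\times(Nm+1)}$$ is the Jacobian matrix of $\bm{G}$ at $\bm{U}$. Norms. $\|\cdot\|_1$ is the $\ell^1$-norm on vectors and the induced operator norm on matrices; $A^{+}$ is the (Moore--Penrose) pseudoinverse of $A$. Free-horizon Newton update. The parameters $\alpha_1,\alpha_2,\bar S>0$ and $\sigma_k$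 (here $\sigma_k=0$) control the step sizes. Given an initial guess $\bm{U}_0=(\bm{u}_0^\top,T_0)^\top$, set $\bm{U}_{k+1}=\bm{U}_k-\bm{W}_k$, where $\bm{U}_k=(\bm{u}_k^\top,T_k)^\top$ and $\bm{W}_k=(\bm{w}_k^\top,S_k)^\top\in\mathbb{R}^{Nm+1}$ (with $\bm{w}_k\in\mathbb{R}^{Nm}$, $S_k\in\mathbb{R}$) is determined by solving $$\underset{\bm{w}_k,S_k}{\text{minimize}}\ \ T_k\|\bm{u}_k-\bm{w}_k\|_1-S_k\|\bm{u}_k\|_1$$ subject to $$\mathcal{J}_{\bm{G}}(\bm{U}_k)\bm{W}_k=\bm{G}(\bm{U}_k),$$ $$\|\bm{w}_k\|_1\le\alpha_1\max(\|\bm{G}(\bm{U}_k)\|_1,\sigma_k),$$ $$|S_k|\le\min\bigl(\bar S,\ \alpha_2\max(\|\bm{G}(\bm{U}_k)\|_1,\sigma_k)\bigr).$$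
   Formalization: The domain 𝒰 is assumed to contain all iterates U_k and the whole segments from U_k to U_{k+1} (automatic if 𝒰 is convex and contains the iterates), and G is assumed differentiable on 𝒰; without the segments the claim can fail. *)

(* Defs.v *)
From HB Require Import structures.
From mathcomp Require Import all_boot all_order all_algebra.
From mathcomp Require Import all_classical all_reals all_analysis.
Import Order.TTheory GRing.Theory Num.Theory.
Import numFieldNormedType.Exports.

Set Implicit Arguments.
Unset Strict Implicit.
Unset Printing Implicit Defensive.

Local Open Scope classical_set_scope.
Local Open Scope ring_scope.

Definition l1norm (R : realType) (n : nat) (v : 'cV[R]_n) : R :=
  \sum_i `|v i 0|.

Definition l1opnorm (R : realType) (m n : nat) (A : 'M[R]_(m, n)) : R :=
  sup [set l1norm (A *m v) | v in [set v : 'cV[R]_n | l1norm v <= 1]].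

(* The four Penrose conditions; over the reals the adjoint is the transpose. *)
Definition is_mp_inverse (R : realType) (m n : nat)
    (A : 'M[R]_(m, n)) (P : 'M[R]_(n, m)) : Prop :=
  [/\ A *m P *m A = A, P *m A *m P = P,
      (A *m P)^T = A *m P & (P *m A)^T = P *m A].

(* Not MathComp's [pinvmx], which is only some partial inverse.  The default
   value 0 is never used: see [mp_inverseP] and [mp_inverse_unique]. *)
Definition mp_inverse (R : realType) (m n : nat) (A : 'M[R]_(m, n)) : 'M[R]_(n, m) :=
  xget 0 [set P | is_mp_inverse A P].

Lemma gram_unit (R : realType) (m n : nat) (A : 'M[R]_(m, n)) :
  row_free A -> A *m A^T \in unitmx.
Proof.
move=> fA; rewrite -row_free_unit -kermx_eq0; apply/eqP/row_matrixP => i.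
rewrite row0; set v := row i _.
have : v *m (A *m A^T) = 0 by apply/sub_kermxP; rewrite row_sub.
move=> /(congr1 (fun w => (w *m v^T) 0 0)); rewrite mul0mx [in RHS]mxE.
rewrite mulmxA -mulmxA -trmx_mul mxE => h.
suff vA : v *m A = 0 by apply: (row_free_inj fA); rewrite mul0mx.
have sq j : 0 <= (v *m A) 0 j * ((v *m A)^T) j 0 by rewrite [_^T _ _]mxE sqr_ge0.
apply/rowP => j; rewrite [RHS]mxE; apply/eqP.
have /eqP := h; rewrite psumr_eq0 => [|k _]; last exact: sq.
by move=> /allP/(_ j (mem_index_enum j)) /=; rewrite [_^T _ _]mxE mulf_eq0 orbb.
Qed.

Lemma mp_inverseP (R : realType) (m n : nat) (A : 'M[R]_(m, n)) : is_mp_inverse A (mp_inverse A).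
Proof.
suff [P AP] : exists P, is_mp_inverse A P by exact: (xgetPex 0 (ex_intro _ P AP)).
have [r [C [B [AE fB fC]]]] : exists r (C : 'M[R]_(m, r)) (B : 'M[R]_(r, n)),
    [/\ A = C *m B, row_free B & row_free C^T].
  exists (\rank A), (col_base A), (row_base A).
  rewrite mulmx_base row_base_free /row_free mxrank_tr; split => //.
  exact: col_base_full.
have uB : B *m B^T \in unitmx by exact: gram_unit.
have uC : C^T *m C \in unitmx by have := gram_unit fC; rewrite trmxK.
pose X := invmx (B *m B^T); pose Y := invmx (C^T *m C).
have XT : X^T = X by rewrite trmx_inv trmx_mul trmxK.
have YT : Y^T = Y by rewrite trmx_inv trmx_mul trmxK.
have BX : B *m (B^T *m X) = 1%:M by rewrite mulmxA mulmxV.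
have YC : Y *m (C^T *m C) = 1%:M by rewrite mulVmx.
exists (B^T *m X *m (Y *m C^T)).
have AP : A *m (B^T *m X *m (Y *m C^T)) = C *m (Y *m C^T).
  by rewrite AE -!mulmxA (mulmxA B^T) (mulmxA B) BX mul1mx.
have PA : B^T *m X *m (Y *m C^T) *m A = B^T *m X *m B.
  by rewrite AE -!mulmxA (mulmxA C^T) (mulmxA Y) YC mul1mx.
split.
- by rewrite AP AE -!mulmxA (mulmxA C^T) (mulmxA Y) YC mul1mx.
- rewrite PA -!mulmxA; congr (_ *m (_ *m _)).
  by rewrite (mulmxA B^T) (mulmxA B) BX mul1mx.
- by rewrite AP !trmx_mul trmxK YT mulmxA.
- by rewrite PA !trmx_mul trmxK XT mulmxA.
Qed.

Lemma mp_inverse_unique (R : realType) (m n : nat) (A : 'M[R]_(m, n)) P :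
  is_mp_inverse A P -> P = mp_inverse A.
Proof.
have [] := mp_inverseP A; set Q := mp_inverse A => q1 q2 q3 q4 [p1 p2 p3 p4].
have e : A *m P = A *m Q.
  have := p3; rewrite -[X in (X *m P)^T]q1 -(mulmxA (A *m Q)) trmx_mul p3 q3.
  by rewrite mulmxA p1.
have e' : P *m A = Q *m A.
  have := p4; rewrite -[X in (P *m X)^T]q1 -mulmxA mulmxA trmx_mul q4 p4.
  by rewrite -mulmxA (mulmxA A) p1.
by rewrite -p2 -mulmxA e mulmxA e' q2.
Qed.

Definition jac (R : realType) (p n : nat) (G : 'cV[R]_p -> 'cV[R]_n)
    (U : 'cV[R]_p) : 'M[R]_(n, p) :=
  \matrix_(i, j) ('D_(delta_mx j 0) G U) i 0.

Lemma jacE (R : realType) (p n : nat) (G : 'cV[R]_p -> 'cV[R]_n) U V :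
  differentiable G U -> 'd G U V = jac G U *m V.
Proof.
move=> dG; rewrite [in LHS](matrix_sum_delta V) linear_sum /=.
apply/colP => i; rewrite summxE mxE; apply: eq_bigr => j _.
by rewrite big_ord1 linearZ /= mxE [in RHS]mxE -deriveE // mulrC.
Qed.

(* The extended decision vector (u^T, T)^T has [usubmx] part u and last
   coordinate T. *)
Definition horizon (R : realType) (p : nat) (U : 'cV[R]_(p + 1)) : R :=
  dsubmx U 0 0.

(* The j-th block of length m of u ([mxvec_index] is row-major); the value 0
   for N <= j is never used below. *)
Definition input (R : realType) (N m : nat) (u : 'cV[R]_(N * m)) (j : nat) :
    'cV[R]_m :=
  if insub j is Some j' then \col_i u (mxvec_index (j' : 'I_N) i) 0 else 0.

Fixpoint state (R : realType) (n m N : nat)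
    (f : 'cV[R]_n -> 'cV[R]_m -> R -> 'cV[R]_n) (x0 : 'cV[R]_n)
    (U : 'cV[R]_(N * m + 1)) (j : nat) : 'cV[R]_n :=
  if j is j'.+1 then
    f (state f x0 U j') (input (usubmx U) j') (horizon U / N%:R)
  else x0.

Definition terminal_error (R : realType) (n m N : nat)
    (f : 'cV[R]_n -> 'cV[R]_m -> R -> 'cV[R]_n) (x0 xf : 'cV[R]_n)
    (U : 'cV[R]_(N * m + 1)) : 'cV[R]_n :=
  state f x0 U N - xf.

Definition newton_feasible (R : realType) (p n : nat)
    (G : 'cV[R]_(p + 1) -> 'cV[R]_n) (alpha1 alpha2 Sbar sigma : R)
    (U W : 'cV[R]_(p + 1)) : Prop :=
  [/\ jac G U *m W = G U,
      l1norm (usubmx W) <= alpha1 * Num.max (l1norm (G U)) sigma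
    & `|horizon W| <=
        Num.min Sbar (alpha2 * Num.max (l1norm (G U)) sigma)].

Definition newton_cost (R : realType) (p : nat) (U W : 'cV[R]_(p + 1)) : R :=
  horizon U * l1norm (usubmx U - usubmx W) - horizon W * l1norm (usubmx U).

Definition newton_solution (R : realType) (p n : nat)
    (G : 'cV[R]_(p + 1) -> 'cV[R]_n) (alpha1 alpha2 Sbar sigma : R)
    (U W : 'cV[R]_(p + 1)) : Prop :=
  newton_feasible G alpha1 alpha2 Sbar sigma U W /\
  forall V, newton_feasible G alpha1 alpha2 Sbar sigma U V ->
    newton_cost U W <= newton_cost U V.

(* [W k] is an arbitrary minimizer of the k-th subproblem.  Solvability of the
   subproblem is not part of the definition: [W k] is only required to be a
   minimizer when there is one, so that solvability along the iteration has to
   be derived. *)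
Definition newton_iteration (R : realType) (p n : nat)
    (G : 'cV[R]_(p + 1) -> 'cV[R]_n) (alpha1 alpha2 Sbar : R) (sigma : nat -> R)
    (U W : nat -> 'cV[R]_(p + 1)) : Prop :=
  forall k,
    ((exists V, newton_solution G alpha1 alpha2 Sbar (sigma k) (U k) V) ->
     newton_solution G alpha1 alpha2 Sbar (sigma k) (U k) (W k)) /\
    U k.+1 = U k - W k.

(* Main.v *)
Require Import Defs.
From HB Require Import structures.
From mathcomp Require Import all_boot all_order all_algebra.
From mathcomp Require Import all_classical all_reals all_analysis.
From mathcomp Require Import ring lra.
Import Order.TTheory GRing.Theory Num.Theory.
Import numFieldNormedType.Exports.
Local Open Scope classical_set_scope.
Local Open Scope ring_scope.

(** This is the Newton--Kantorovich estimate, with the step confined by the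
    bounds on [w] and [S] instead of being the full pseudoinverse step.

    The subproblem always has a solution.  Since [dG/du] has full row rank,
    [w = (dG/du)^+ G] together with [S = 0] solves the linear constraint, and
    the bound on the pseudoinverse keeps this step within the bound on [w]
    ([newton_feasible_exists]).  The two norm bounds make the feasible set
    compact, so the continuous cost attains its minimum on it
    ([newton_solution_exists]).  Hence every step of the iteration is a
    minimizer, in particular it is feasible.

    A feasible step [W] has [|W|_1 <= (alpha1 + alpha2) |G(U)|_1] and cancels
    the linearization of [G] at [U], so [G (U - W)] is a pure linearization
    error.  As the Jacobian is [lambda]-Lipschitz along the step, that error is
    at most [lambda/2 |W|_1^2] ([linearization_error]), whence
      [|G(U - W)|_1 <= C |G(U)|_1^2], [C = lambda (alpha1 + alpha2)^2 / 2]
    ([newton_residual_quadratic]).  The smallness of the initial residual says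
    exactly that [C |G(U_0)|_1 < 1]; the residuals then decrease and are
    dominated by a geometric sequence of that ratio ([quadratic_decay_cvg0]). *)

Set Implicit Arguments.
Unset Strict Implicit.
Unset Printing Implicit Defensive.

(** * The l1 norm and its operator norm *)

Lemma l1norm_ge0 (R : realType) (n : nat) (v : 'cV[R]_n) : 0 <= l1norm v.
Proof. exact: sumr_ge0. Qed.

Lemma l1normZ (R : realType) (n : nat) (a : R) (v : 'cV[R]_n) :
  l1norm (a *: v) = `|a| * l1norm v.
Proof. by rewrite mulr_sumr; apply: eq_bigr => i _; rewrite mxE normrM. Qed.

Lemma l1norm_eq0 (R : realType) (n : nat) (v : 'cV[R]_n) :
  l1norm v = 0 -> v = 0.
Proof.
move/eqP; rewrite psumr_eq0// => /allP v0; apply/colP => i; rewrite mxE.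
by apply/eqP; rewrite -normr_eq0; apply: v0; rewrite mem_index_enum.
Qed.

Lemma entry_le_l1norm (R : realType) (n : nat) (v : 'cV[R]_n) i :
  `|v i 0| <= l1norm v.
Proof. by rewrite /l1norm (bigD1 i)//= lerDl sumr_ge0. Qed.

Lemma l1norm_split (R : realType) (p : nat) (V : 'cV[R]_(p + 1)) :
  l1norm V = l1norm (usubmx V) + `|horizon V|.
Proof.
rewrite /l1norm big_split_ord /= big_ord1 /horizon mxE.
by congr (_ + _); apply: eq_bigr => i _; rewrite mxE.
Qed.

(** [l1opnorm] is a supremum in the reals, hence meaningless until its set of
    values is known to be bounded; the sum of all entries is a crude bound. *)
Lemma l1opnorm_has_ubound (R : realType) (m n : nat) (A : 'M[R]_(m, n)) :
  has_ubound [set l1norm (A *m v) | v in [set v : 'cV[R]_n | l1norm v <= 1]].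
Proof.
exists (\sum_i \sum_j `|A i j|) => _ [v /= v1 <-]; apply: ler_sum => i _.
rewrite mxE (le_trans (ler_norm_sum _ _ _))//; apply: ler_sum => j _.
by rewrite normrM ler_piMr// (le_trans (entry_le_l1norm v j)).
Qed.

Lemma l1norm_mulmx (R : realType) (m n : nat) (A : 'M[R]_(m, n)) v :
  l1norm (A *m v) <= l1opnorm A * l1norm v.
Proof.
have [v0|v_gt0] := leP (l1norm v) 0.
  have /l1norm_eq0 -> : l1norm v = 0 by apply/le_anti; rewrite v0 l1norm_ge0.
  by rewrite mulmx0 -(scale0r (0 : 'cV_m)) l1normZ normr0 mul0r
    -(scale0r (0 : 'cV_n)) l1normZ normr0 mul0r mulr0.
rewrite -ler_pdivrMr// -[X in X <= _](_ : l1norm (A *m ((l1norm v)^-1 *: v)) = _).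
  apply: (ub_le_sup (l1opnorm_has_ubound A)); exists ((l1norm v)^-1 *: v) => //=.
  by rewrite l1normZ gtr0_norm ?invr_gt0// mulVf ?gt_eqF.
by rewrite -scalemxAr l1normZ gtr0_norm ?invr_gt0// mulrC.
Qed.

(** * Solvability of the Newton subproblem *)

Lemma mulmx_mp_inverse (R : realType) (m n : nat) (A : 'M[R]_(m, n)) :
  row_free A -> A *m mp_inverse A = 1%:M.
Proof.
move=> /row_free_inj fA; have [APA _ _ _] := mp_inverseP A.
by apply: fA; rewrite APA mul1mx.
Qed.

(** The pseudoinverse step in [u], leaving the horizon [T] alone, is feasible;
    this is where full row rank and the pseudoinverse bound are used. *)
Lemma newton_feasible_exists (R : realType) (p n : nat)
    (G : 'cV[R]_(p + 1) -> 'cV[R]_n) (alpha1 alpha2 Sbar sigma : R) U :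
  0 <= alpha1 -> 0 <= alpha2 -> 0 <= Sbar ->
  row_free (lsubmx (jac G U)) ->
  l1opnorm (mp_inverse (lsubmx (jac G U))) <= alpha1 ->
  exists V, newton_feasible G alpha1 alpha2 Sbar sigma U V.
Proof.
move=> a1 a2 S0 fA leA.
have AP := mulmx_mp_inverse fA; move: leA AP; set P := mp_inverse _ => leP AP.
exists (col_mx (P *m G U) 0); split.
- by rewrite -[jac G U]hsubmxK mul_row_col mulmx0 addr0 mulmxA AP mul1mx.
- rewrite col_mxKu (le_trans (l1norm_mulmx _ _))//.
  apply: (le_trans (ler_wpM2r (l1norm_ge0 _) leP)).
  by rewrite ler_wpM2l// le_max lexx.
- rewrite /horizon col_mxKd mxE normr0 le_min S0 mulr_ge0//.
  by rewrite le_max l1norm_ge0.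
Qed.

Lemma trmx_continuous (R : realType) (m n : nat) :
  continuous (trmx : 'M[R]_(m, n) -> 'M[R]_(n, m)).
Proof.
move=> M s /= /nbhs_ballP[e e0 es]; apply/nbhs_ballP; exists e => //= N [_ MN].
by apply: es; split => // i j; rewrite !mxE; exact: MN.
Qed.

(** A box of column vectors is the transpose of a box of row vectors, which is
    compact by Tychonoff's theorem. *)
Lemma cV_box_compact (R : realType) (n : nat) (M : R) :
  compact [set v : 'cV[R]_n | forall i, `|v i 0| <= M].
Proof.
rewrite [X in compact X](_ : _ =
  trmx @` [set v : 'rV[R]_n | forall i, [set` `[- M, M]] (v ord0 i)]).
  apply: continuous_compact; first exact/continuous_subspaceT/trmx_continuous.
  apply: (@rV_compact _ _ (fun=> `[- M, M]%classic)) => _.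
  exact: segment_compact.
apply/seteqP; split => [v vM|_ [v vM <-] i].
  exists v^T; last by rewrite trmxK.
  by move=> i /=; rewrite mxE in_itv/= -ler_norml.
by have := vM i; rewrite /= mxE in_itv/= -ler_norml.
Qed.

Lemma l1norm_sub_continuous (R : realType) (n : nat) (a : 'cV[R]_n) :
  continuous (fun v : 'cV[R]_n => l1norm (a - v)).
Proof.
apply: continuous_big => [|i _]; first exact: add_continuous.
under [X in continuous X]eq_fun do rewrite !mxE.
move=> v.
apply: (@continuous_comp _ _ _ (fun v : 'cV[R]_n => v i 0)
  (fun x => `|a i 0 - x|)); first exact: coord_continuous.
by apply: cvg_norm; apply: cvgB; [exact: cvg_cst|exact: cvg_id].
Qed.

Lemma l1norm_continuous (R : realType) (n : nat) :
  continuous (@l1norm R n).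
Proof.
move=> v; have := @l1norm_sub_continuous R n 0 v; congr (continuous_at _ _).
by apply/funext => w; rewrite sub0r -scaleN1r l1normZ normrN1 mul1r.
Qed.

Lemma mulmx_entry_continuous (R : realType) (m n : nat) (A : 'M[R]_(m, n)) i :
  continuous (fun v : 'cV[R]_n => (A *m v) i 0).
Proof.
under [X in continuous X]eq_fun do rewrite mxE.
apply: continuous_big => [|j _]; first exact: add_continuous.
move=> v; apply: (@continuous_comp _ _ _ (fun v : 'cV[R]_n => v j 0) ( *%R _)).
  exact: coord_continuous.
exact: mulrl_continuous.
Qed.

Lemma usubmx_continuous (R : realType) (m1 m2 n : nat) :
  continuous (usubmx : 'M[R]_(m1 + m2, n) -> 'M[R]_(m1, n)).
Proof.
move=> M s /= /nbhs_ballP[e e0 es]; apply/nbhs_ballP; exists e => //= N [_ MN].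
by apply: es; split => // i j; rewrite !mxE; exact: MN.
Qed.

Lemma horizon_continuous (R : realType) (p : nat) :
  continuous (@horizon R p).
Proof.
rewrite [@horizon R p](_ : _ = fun V : 'cV[R]_(p + 1) => V (rshift p 0) 0).
  exact: coord_continuous.
by apply/funext => V; rewrite /horizon mxE.
Qed.

(** Extreme value theorem: the norm bounds on [w] and [S] together bound the
    whole step, so the feasible set is closed and contained in a box. *)
Lemma newton_solution_exists (R : realType) (p n : nat)
    (G : 'cV[R]_(p + 1) -> 'cV[R]_n) (alpha1 alpha2 Sbar sigma : R) U :
  (exists V, newton_feasible G alpha1 alpha2 Sbar sigma U V) ->
  exists W, newton_solution G alpha1 alpha2 Sbar sigma U W.
Proof.
move=> feas.
have closedF : closed [set V | newton_feasible G alpha1 alpha2 Sbar sigma U V].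
  rewrite [X in closed X](_ : _ =
    (\bigcap_i ((fun V : 'cV_(p + 1) => (jac G U *m V) i 0)
        @^-1` [set x | x = G U i 0]))
    `&` ((@l1norm R p \o usubmx) @^-1`
          [set x | x <= alpha1 * Num.max (l1norm (G U)) sigma])
    `&` ((Num.norm \o @horizon R p) @^-1`
      [set x | x <= Num.min Sbar (alpha2 * Num.max (l1norm (G U)) sigma)])).
    apply: closedI; first apply: closedI.
    - apply: closed_bigI => i _; apply: preimage_closed (@closed_eq _ _).
      by move=> V _; exact: mulmx_entry_continuous.
    - apply: preimage_closed (@closed_le _ _) => V _.
      apply: continuous_comp; first exact: usubmx_continuous.
      exact: l1norm_continuous.
    - apply: preimage_closed (@closed_le _ _) => V _.
      apply: continuous_comp; first exact: horizon_continuous.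
      exact: norm_continuous.
  apply/seteqP; split => V /=.
    by move=> [JV uV hV]; do !split => //; move=> i _; rewrite /= JV.
  by move=> [[JV uV] hV]; split => //; apply/colP => i; exact: JV.
have compactF : compact [set V | newton_feasible G alpha1 alpha2 Sbar sigma U V].
  apply: subclosed_compact closedF (@cV_box_compact R _
    (alpha1 * Num.max (l1norm (G U)) sigma +
     Num.min Sbar (alpha2 * Num.max (l1norm (G U)) sigma))) _.
  move=> V [_ uV hV] i.
  by rewrite (le_trans (entry_le_l1norm V i))// l1norm_split lerD.
have costC : continuous (newton_cost U).
  move=> V; apply: (@continuousB _ _ _
    (fun V : 'cV[R]_(p + 1) => horizon U * l1norm (usubmx U - usubmx V))
    (fun V : 'cV[R]_(p + 1) => horizon V * l1norm (usubmx U))).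
    apply: (@continuous_comp _ _ _
      (fun V : 'cV[R]_(p + 1) => l1norm (usubmx U - usubmx V))
      ( *%R (horizon U))); last exact: mulrl_continuous.
    apply: (@continuous_comp _ _ _ usubmx
      (fun v : 'cV[R]_p => l1norm (usubmx U - v))).
      exact: usubmx_continuous.
    exact: l1norm_sub_continuous.
  apply: (@continuous_comp _ _ _ (@horizon R p) ( *%R^~ (l1norm (usubmx U)))).
    exact: horizon_continuous.
  exact: mulrr_continuous.
have [W /set_mem FW minW] :=
  compact_EVT_min feas compactF (continuous_subspaceT costC).
by exists W; split => // V FV; apply: minW; exact/mem_set.
Qed.

(** * Quadratic decrease of the residual *)

Lemma is_derive_along_segment (R : realType) (p n : nat)
    (G : 'cV[R]_p -> 'cV[R]_n) (U W : 'cV[R]_p) (t : R) i :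
  differentiable G (U - t *: W) ->
  is_derive t 1 (fun t => G (U - t *: W) i 0)
    (- (jac G (U - t *: W) *m W) i 0).
Proof.
move=> dG.
have dl : is_diff t (fun t : R => U - t *: W) (fun h : R => - (h *: W)).
  have := @is_diffB _ _ _ _ _ _ _ _ (is_diff_cst U t) (is_diff_scalel t W).
  move=> h; apply: is_diff_eq h _.
  by apply/funext => h /=; rewrite fctE /= add0r.
have dGl : differentiable (G \o (fun t : R => U - t *: W)) t.
  by apply: differentiable_comp.
split.
  apply: diff_derivable.
  exact: (differentiable_comp dGl (differentiable_coord _ i 0)).
have DGl : 'D_1 _ t = _ := derive_mx (diff_derivable dGl).
have := congr1 (fun A : 'cV[R]_n => A i 0) DGl.
rewrite [in RHS]mxE /= => <-; rewrite deriveE// diff_comp//= diff_val jacE//.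
by rewrite scale1r mulmxN mxE.
Qed.

(** Differentiability along the segment says nothing about integrability of the
    Jacobian, so the mean value theorem replaces the usual integral remainder.
    The vector statement reduces to one scalar function by pairing with the
    signs of the error [e], because [|e|_1 = sum_i sg(e_i) e_i].  The term
    [L/2 |W|_1 t^2] is subtracted so that the derivative is nonpositive on all
    of the segment: its derivative absorbs the bound [L t |W|_1] on the drift of
    the Jacobian, and this is what yields the factor 1/2. *)
Lemma linearization_error (R : realType) (p n : nat)
    (G : 'cV[R]_p -> 'cV[R]_n) (U W : 'cV[R]_p) (L : R) :
  (forall t : R, 0 <= t <= 1 -> differentiable G (U - t *: W)) ->
  (forall t : R, 0 <= t <= 1 ->
     l1opnorm (jac G U - jac G (U - t *: W)) <= L * t) ->
  l1norm (G (U - W) - (G U - jac G U *m W)) <= L / 2 * l1norm W.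
Proof.
move=> dG lipG.
set e := G (U - W) - _.
pose s i := Num.sg (e i 0).
pose K i := (jac G U *m W) i 0.
pose f : R -> R :=
  \sum_i s i \*: ((fun t : R => G (U - t *: W) i 0) + K i \*: id)
  - (L / 2 * l1norm W) \*: (id ^+ 2).
pose df (t : R) :=
  \sum_i s i * ((jac G U - jac G (U - t *: W)) *m W) i 0 - L * l1norm W * t.
have fE t : f t = \sum_i s i * (G (U - t *: W) i 0 + K i * t)
    - L / 2 * l1norm W * t ^+ 2.
  by rewrite /f fctE fct_sumE.
have fD (t : R) : 0 <= t <= 1 -> is_derive t 1 f (df t).
  move=> t01; apply: is_deriveB.
    apply: is_derive_sum => i; apply: is_deriveZ.
    apply: is_derive_eq.
      by apply: is_deriveD; exact: is_derive_along_segment (dG t t01).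
    by rewrite mulmxBl /K -[_%:A]/(_ * 1) mulr1 addrC !mxE.
  apply: is_derive_eq.
  by rewrite /GRing.scale /= expr1; lra.
have cf : {within `[0, 1], continuous f}.
  apply: derivable_within_continuous => t; rewrite in_itv /= => t01.
  by have [] := fD t t01.
have [t|c c01 fc] := @MVT R f df 0 1 ltr01 _ cf.
  by move=> /subset_itv_oo_cc; rewrite in_itv /=; exact: fD.
have {}c01 : 0 <= c <= 1 by move: c01 => /subset_itv_oo_cc; rewrite in_itv.
have dfc : df c <= 0.
  rewrite subr_le0 mulrAC (le_trans _ (ler_wpM2r (l1norm_ge0 W) (lipG c c01)))//.
  apply: le_trans (l1norm_mulmx _ _); apply: ler_sum => i _.
  by rewrite (le_trans (ler_norm _))// normrM ler_piMl// normr_sg; case: eqP.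
have f10 : f 1 - f 0 = l1norm e - L / 2 * l1norm W.
  rewrite !fE expr1n expr0n /= mulr1 mulr0 subr0 addrAC -sumrB scale1r scale0r.
  rewrite subr0; congr (_ - _); apply: eq_bigr => i _.
  rewrite mulr1 mulr0 addr0 -mulrBr normrEsg; congr (_ * _).
  by rewrite /K /e !mxE; lra.
by rewrite -subr_le0 -f10 fc subr0 mulr1.
Qed.

(** Each constraint of the subproblem has its part: the linear one removes the
    terms of order 0 and 1 of [G (U - W)], the norm bounds compare the step with the
    residual, and [|S| <= Sbar] is what allows the Lipschitz hypothesis to be
    applied along the whole step. *)
Lemma newton_residual_quadratic (R : realType) (p n : nat)
    (G : 'cV[R]_(p + 1) -> 'cV[R]_n) (alpha1 alpha2 Sbar lambda : R)
    (D : set 'cV[R]_(p + 1)) (U W : 'cV[R]_(p + 1)) :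
  0 < lambda ->
  (forall V, D V -> differentiable G V) ->
  (forall V' V'', D V' -> D V'' -> `|horizon V' - horizon V''| <= Sbar ->
     l1opnorm (jac G V' - jac G V'') <= lambda * l1norm (V' - V'')) ->
  (forall t : R, 0 <= t <= 1 -> D (U - t *: W)) ->
  newton_feasible G alpha1 alpha2 Sbar 0 U W ->
  l1norm (G (U - W)) <=
    lambda * (alpha1 + alpha2) ^+ 2 / 2 * l1norm (G U) ^+ 2.
Proof.
move=> lambda_gt0 dG lipG segD [JW]; set g := l1norm (G U).
rewrite (_ : Num.max g 0 = g); last exact/max_idPl/l1norm_ge0.
rewrite le_min => uW /andP[hS hW].
have DU : D U by have := segD 0; rewrite scale0r subr0; apply; rewrite lexx ler01.
have normW : l1norm W <= (alpha1 + alpha2) * g.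
  by rewrite l1norm_split mulrDl lerD.
have lip (t : R) : 0 <= t <= 1 ->
    l1opnorm (jac G U - jac G (U - t *: W)) <= lambda * l1norm W * t.
  move=> t01; have /andP[t0 t1] := t01.
  have tW : U - (U - t *: W) = t *: W by rewrite opprB addrC subrK.
  have hz : `|horizon U - horizon (U - t *: W)| <= Sbar.
    rewrite (_ : _ - _ = t * horizon W); last by rewrite /horizon !mxE; lra.
    by rewrite normrM ger0_norm// (le_trans (ler_piMl _ t1)).
  apply: le_trans (lipG _ _ DU (segD t t01) hz) _.
  by rewrite tW l1normZ (ger0_norm t0) mulrCA mulrC.
have := linearization_error (fun t t01 => dG _ (segD t t01)) lip.
rewrite JW subrr subr0 => /le_trans; apply.
rewrite [leLHS](_ : _ = lambda / 2 * l1norm W ^+ 2); last by ring.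
rewrite [leRHS](_ : _ = lambda / 2 * ((alpha1 + alpha2) * g) ^+ 2).
  rewrite ler_pM2l ?divr_gt0//.
  by rewrite lerXn2r// nnegrE ?l1norm_ge0// (le_trans (l1norm_ge0 W)).
by ring.
Qed.

(** As long as [g k <= g 0], one factor [g k] of the quadratic bound turns into
    the fixed ratio [C * g 0 < 1]; the resulting geometric bound in turn
    propagates [g k <= g 0]. *)
Lemma quadratic_decay_cvg0 (R : realType) (g : nat -> R) (C : R) :
  0 < C -> (forall k, 0 <= g k) -> (forall k, g k.+1 <= C * g k ^+ 2) ->
  C * g 0%N < 1 -> g @ \oo --> (0 : R).
Proof.
move=> C_gt0 g_ge0 step q_lt1; pose q := C * g 0%N.
have q_ge0 : 0 <= q by rewrite mulr_ge0// ltW.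
have geo k : g k <= geometric (g 0%N) q k.
  rewrite /geometric /=; elim: k => [|k gk]; first by rewrite expr0 mulr1.
  have gk0 : g k <= g 0%N.
    by rewrite (le_trans gk)// ler_piMr// exprn_ile1// ltW.
  rewrite (le_trans (step k))// [in leRHS]exprS [leRHS]mulrCA expr2 mulrA.
  apply: ler_pM => //; first by rewrite mulr_ge0// ltW.
  by rewrite ler_pM2l.
apply: (@squeeze_cvgr _ _ _ R (fun=> 0) (geometric (g 0%N) q)).
- by apply: nearW => k; rewrite g_ge0 geo.
- exact: cvg_cst.
- by apply: cvg_geometric; rewrite ger0_norm.
Qed.

Theorem theorem1 (R : realType) (n m N : nat)
    (n_gt0 : (0 < n)%N) (m_gt0 : (0 < m)%N) (N_gt0 : (0 < N)%N)
    (f : 'cV[R]_n -> 'cV[R]_m -> R -> 'cV[R]_n) (x0 xf : 'cV[R]_n)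
    (G : 'cV[R]_(N * m + 1) -> 'cV[R]_n) (GE : G = terminal_error f x0 xf)
    (alpha1 alpha2 Sbar : R)
    (alpha1_gt0 : 0 < alpha1) (alpha2_gt0 : 0 < alpha2) (Sbar_gt0 : 0 < Sbar)
    (UU : set 'cV[R]_(N * m + 1))
    (UU_horizon : forall V, UU V -> 0 < horizon V)
    (UU_diff : forall V, UU V -> differentiable G V)
    (A1 : forall V, UU V -> row_free (lsubmx (jac G V)))
    (A2 : forall V, UU V -> l1opnorm (mp_inverse (lsubmx (jac G V))) <= alpha1)
    (lambda : R) (lambda_gt0 : 0 < lambda)
    (A3 : forall V' V'', UU V' -> UU V'' ->
       `|horizon V' - horizon V''| <= Sbar ->
       l1opnorm (jac G V' - jac G V'') <= lambda * l1norm (V' - V''))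
    (U W : nat -> 'cV[R]_(N * m + 1))
    (A4 : lambda * (alpha1 + alpha2) ^+ 2 * l1norm (G (U 0%N)) / 2 < 1)
    (U_iter : newton_iteration G alpha1 alpha2 Sbar (fun=> 0) U W)
    (* the iterates, and the Newton steps joining them, stay in the domain *)
    (U_in : forall k (t : R), 0 <= t <= 1 -> UU (U k - t *: W k)) :
  (fun k => l1norm (G (U k))) @ \oo --> (0 : R) /\
  exists2 C : R, 0 < C &
    forall k, l1norm (G (U k.+1)) <= C * l1norm (G (U k)) ^+ 2.
Proof.
have UU_k k : UU (U k).
  by have := U_in k 0; rewrite scale0r subr0; apply; rewrite lexx ler01.
have feasW k : newton_feasible G alpha1 alpha2 Sbar 0 (U k) (W k).
  apply: (proj1 ((U_iter k).1 _)).
  apply/newton_solution_exists/newton_feasible_exists; try exact: ltW.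
    exact: A1.
  exact: A2.
pose C := lambda * (alpha1 + alpha2) ^+ 2 / 2.
have C_gt0 : 0 < C by rewrite divr_gt0// mulr_gt0// exprn_gt0// addr_gt0.
have step k : l1norm (G (U k.+1)) <= C * l1norm (G (U k)) ^+ 2.
  rewrite (U_iter k).2.
  exact: newton_residual_quadratic lambda_gt0 UU_diff A3 (U_in k) (feasW k).
split; last by exists C.
apply: (quadratic_decay_cvg0 C_gt0 _ step) => [k|]; first exact: l1norm_ge0.
by rewrite /C mulrAC.
Qed.
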